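(* Let $G=(V_1\sqcup V_2,E)$ be a finite bipartite graph with $\#V_1<\#V_2$ and edge weights $\lambda(e)\ge 0$ such that the total weight of perfect matchings of the unbalanced bipartite graph $G$ is positive. Let $V_3$ be a set of $\#V_2-\#V_1$ new nodes, and let $G'$ be the balanced bipartite graph with node partition $(V_1\sqcup V_3,V_2)$ and edge set $E'=E\cup\{\{a,b\}:a\in V_3,\ b\in V_2\}$, where edges in $E$ keep their weights and each new edge has weight 1. If $X'$ is drawn from the weighted perfect matching distribution on $G'$ and $X\in\{0,1\}^E$ is given by $X(e)=X'(e)$ for all $e\in E$, then $X$ is distributed according to the weighted perfect matching distribution on the unbalanced bipartite graph $G$.
   Context: In a bipartite graph with partition $(A,B)$ every edge has exactly one endpoint in $A$ and one in $B$. A configuration is $x\in\{0,1\}^E$, and the degree of a node $i$ under $x$ is the number of edges $e$ incident to $i$ with $x(e)=1$. For a bipartite graph with $\#A\le\#B$, a configuration $x$ is a perfect matching if every node of $A$ has degree exactly 1 under $x$ and every node of $B$ has degree at most 1 under $x$ (so when $\#A=\#B$ this is a perfect matching in the usual sense). The weighted perfect matching distribution with edge weights $\lambda$ assigns to each perfect matching $x$ probability proportional to $\prod_{e:x(e)=1}\lambda(e)$ (empty product equal to 1), and probability 0 to all other configurations. *)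

(* Defs.v *)
From HB Require Import structures.
From mathcomp Require Import all_boot all_order all_algebra.
From mathcomp Require Import all_classical all_reals all_analysis.

Set Implicit Arguments.
Unset Strict Implicit.
Unset Printing Implicit Defensive.

Import Order.TTheory GRing.Theory Num.Theory.

Local Open Scope ring_scope.
Local Open Scope classical_set_scope.

(* Finite simple bipartite graph with node partition (A, B). The nodes of the
   graph are the elements of A + B, and [ends_inj] rules out parallel edges, so
   that an edge is the same thing as a pair of endpoints. *)
Record bigraph (A B : finType) := Bigraph {
  edge : finType;
  ends : edge -> A * B;
  ends_inj : injective ends
}.

Section Matchings.
Variables (A B : finType) (G : bigraph A B).

Definition config := {ffun edge G -> bool}.

Definition incident (i : A + B) (e : edge G) : bool :=
  match i with
  | inl a => (ends e).1 == a
  | inr b => (ends e).2 == b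
  end.

Definition degree (x : config) (i : A + B) : nat :=
  #|[pred e | incident i e && x e]|.

(* Meant for #|A| <= #|B|; the definition is asymmetric in A and B. *)
Definition perfect_matching (x : config) : bool :=
  [forall a : A, degree x (inl a) == 1%N] &&
  [forall b : B, (degree x (inr b) <= 1)%N].

Variables (R : realType) (lambda : edge G -> R).

Definition weight (x : config) : R := \prod_(e : edge G | x e) lambda e.

Definition total_weight : R := \sum_(x : config | perfect_matching x) weight x.

(* A probability mass function only when [total_weight] is nonzero. *)
Definition pm_dist (x : config) : R :=
  if perfect_matching x then weight x / total_weight else 0.

End Matchings.

Section Balancing.
Variables (V1 V2 V3 : finType) (G : bigraph V1 V2).

(* The edges of the balanced graph are those of G together with one new edge
   (a, b) for each a : V3 and b : V2. *)
Definition balanced_ends (e : edge G + V3 * V2) : (V1 + V3) * V2 :=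
  match e with
  | inl e0 => (inl (ends e0).1, (ends e0).2)
  | inr (a, b) => (inr a, b)
  end.

Lemma balanced_ends_inj : injective balanced_ends.
Proof.
move=> [e|[a b]] [f|[c d]] //= [].
  move=> h1 h2; congr inl; apply: ends_inj.
  by rewrite (surjective_pairing (ends e)) h1 h2 -surjective_pairing.
by move=> -> ->.
Qed.

Definition balanced_graph : bigraph (V1 + V3)%type V2 := Bigraph balanced_ends_inj.

Definition balanced_weight (R : realType) (lambda : edge G -> R) :
    edge balanced_graph -> R :=
  fun e => match e with inl e0 => lambda e0 | inr _ => 1 end.

Definition restrict_config (x' : config balanced_graph) : config G :=
  [ffun e : edge G => x' (inl e)].

End Balancing.

Arguments balanced_graph {V1 V2} V3 G.
Arguments balanced_weight {V1 V2} V3 {G R} lambda e.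
Arguments restrict_config {V1 V2} V3 {G} x'.

(* The random variable Y, with values in the finite set S (all of whose subsets
   are measurable), has probability mass function p. *)
Definition has_law (R : realType) (d : measure_display) (T : measurableType d)
    (P : probability T R) (S : finType) (Y : T -> S) (p : S -> R) : Prop :=
  forall s : S, measurable (Y @^-1` [set s]) /\ P (Y @^-1` [set s]) = (p s)%:E.

(* Main.v *)
(** A perfect matching of G leaves #|V2| - #|V1| nodes of V2 unmatched, and the
    perfect matchings of the balanced graph that restrict to it are exactly the
    injections of V3 into these nodes. Their number (#|V2| - #|V1|) ^_ #|V3| is
    the same for every perfect matching of G, and since new edges have weight 1
    each extension has the weight of its restriction. The restriction map thus
    multiplies all weights by one constant, which cancels on normalising. *)

Require Import Defs.
From HB Require Import structures.
From mathcomp Require Import all_boot all_order all_algebra.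
From mathcomp Require Import all_classical all_reals all_analysis.

Set Implicit Arguments.
Unset Strict Implicit.
Unset Printing Implicit Defensive.

Import Order.TTheory GRing.Theory Num.Theory.

Local Open Scope ring_scope.

(** The preimage of a point is the disjoint union of the events [Y = s] over the finite fibre of
    [g], so finite additivity applies. *)
Lemma has_law_comp (R : realType) (d : measure_display) (T : measurableType d)
    (P : probability T R) (S S' : finType) (Y : T -> S) (p : S -> R)
    (g : S -> S') :
  has_law P Y p ->
  has_law P (fun t => g (Y t)) (fun s' => \sum_(s | g s == s') p s).
Proof.
move=> hY s'.
pose D : set S := [set s | g s == s']%classic.
have -> : ((fun t => g (Y t)) @^-1` [set s'])%classic
        = (\bigcup_(s in D) (Y @^-1` [set s]))%classic.
  apply/seteqP; split => t /=.
    by move=> /eqP gY; exists (Y t).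
  by move=> [s /eqP gs /= ->].
have mY s : measurable (Y @^-1` [set s])%classic by have [] := hY s.
split; first by apply: fin_bigcup_measurable => //; exact: finite_finset.
rewrite measure_fin_bigcup //; last exact: trivIset_preimage1.
  have -> : D = [set` [pred s | g s == s']]%classic by [].
  rewrite -(bigfs _ (index_enum_uniq S)); last first.
    by move=> s _; rewrite mem_index_enum.
  by rewrite -sumEFin; apply: eq_bigr => s _; have [] := hY s.
exact: finite_finset.
Qed.

Lemma card_sum_bool (T : finType) (P : pred T) :
  #|[pred x | P x]| = (\sum_x P x)%N.
Proof.
rewrite -sum1_card big_mkcond /=; apply: eq_bigr => x _.
by rewrite inE; case: (P x).
Qed.

(** * Degree counting in a bipartite graph *)

Section Degrees.
Variables (A B : finType) (G : bigraph A B).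

Lemma degreeE (x : config G) i :
  degree x i = (\sum_e (incident i e && x e))%N.
Proof. exact: card_sum_bool. Qed.

Lemma sum_degree_inl (x : config G) :
  (\sum_a degree x (inl a) = \sum_e x e)%N.
Proof.
under eq_bigr do rewrite degreeE.
rewrite exchange_big /=; apply: eq_bigr => e _.
rewrite (bigD1 (ends e).1) //= eqxx big1 ?addn0 // => a.
by rewrite eq_sym => /negbTE->.
Qed.

Lemma sum_degree_inr (x : config G) :
  (\sum_b degree x (inr b) = \sum_e x e)%N.
Proof.
under eq_bigr do rewrite degreeE.
rewrite exchange_big /=; apply: eq_bigr => e _.
rewrite (bigD1 (ends e).2) //= eqxx big1 ?addn0 // => b.
by rewrite eq_sym => /negbTE->.
Qed.

Definition unmatched (x : config G) : {set B} := [set b | degree x (inr b) == 0%N].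

(** Double counting of the chosen edges: both degree sums count them, and the sum over [A] is [#|A|]
    because each degree there is 1. *)
Lemma card_unmatched (x : config G) :
  perfect_matching x -> (#|unmatched x| = #|B| - #|A|)%N.
Proof.
case/andP=> /forallP hA /forallP hB.
have EA : (\sum_b degree x (inr b) = #|A|)%N.
  rewrite sum_degree_inr -sum_degree_inl -sum1_card.
  by apply: eq_bigr => a _; exact/eqP.
rewrite -EA -sum1_card -[in RHS]sum1_card big_mkcond /=.
(* Adding the degree sum to both sides removes the truncated subtraction. Pointwise, the degree plus
   the indicator of being unmatched is then 1. *)
apply/eqP; rewrite -(eqn_add2r (\sum_b degree x (inr b))) subnK; last first.
  by apply: leq_sum => b _; exact: hB.
rewrite -big_split /=; apply/eqP/eq_bigr => b _; rewrite inE.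
by have := hB b; case: (degree _ _) => [|[|]].
Qed.

End Degrees.

(** * Fibres of the restriction map *)

Section Balanced.
Variables (V1 V2 V3 : finType) (G : bigraph V1 V2).
Local Notation G' := (balanced_graph V3 G).

Lemma degree_balanced_inll (x' : config G') a :
  degree x' (inl (inl a)) = degree (restrict_config V3 x') (inl a).
Proof.
rewrite !degreeE big_sumType /= [X in (_ + X)%N]big1 ?addn0; last by case.
by apply: eq_bigr => e _; rewrite ffunE.
Qed.

Lemma degree_balanced_inlr (x' : config G') a :
  degree x' (inl (inr a)) = #|[pred b | x' (inr (a, b))]|.
Proof.
rewrite degreeE big_sumType /= big1 ?add0n //.
(* Projections replace the match on the pair, so that [pair_bigA] can split the sum into an iterated
   one. *)
rewrite (eq_bigr (fun p : V3 * V2 =>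
  ((p.1 == a) && x' (inr (p.1, p.2))) : nat)).
  rewrite -(pair_bigA _ (fun c b => ((c == a) && x' (inr (c, b))) : nat)) /=.
  rewrite (bigD1 a) //= eqxx [X in (_ + X)%N]big1 ?addn0 => [|c /negbTE ca].
    by rewrite card_sum_bool.
  by rewrite big1 // => b _; rewrite ca.
by case.
Qed.

Lemma degree_balanced_inr (x' : config G') b :
  degree x' (inr b)
  = (degree (restrict_config V3 x') (inr b) + #|[pred a | x' (inr (a, b))]|)%N.
Proof.
rewrite !degreeE big_sumType /=; congr addn.
  by apply: eq_bigr => e _; rewrite ffunE.
rewrite (eq_bigr (fun p : V3 * V2 =>
  ((p.2 == b) && x' (inr (p.1, p.2))) : nat)).
  rewrite -(pair_bigA _ (fun a c => ((c == b) && x' (inr (a, c))) : nat)) /=.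
  rewrite card_sum_bool; apply: eq_bigr => a _.
  by rewrite (bigD1 b) //= eqxx big1 ?addn0 // => c /negbTE->.
by case.
Qed.

Lemma weight_balanced (R : realType) (lambda : edge G -> R) (x' : config G') :
  weight (balanced_weight V3 lambda) x'
  = weight lambda (restrict_config V3 x').
Proof.
rewrite /weight big_sumType /= [X in _ * X]big1 ?mulr1 //.
by apply: eq_bigl => e; rewrite ffunE.
Qed.

Lemma perfect_matching_restrict (x' : config G') :
  perfect_matching x' -> perfect_matching (restrict_config V3 x').
Proof.
case/andP=> /forallP hA /forallP hB; apply/andP; split; apply/forallP.
  by move=> a; rewrite -degree_balanced_inll.
by move=> b; apply: leq_trans (hB b); rewrite degree_balanced_inr leq_addr.
Qed.

(** Here [f] assigns to each new node its partner. It is arbitrary, so that the extension need not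
    be a matching. *)
Definition extend_config (x : config G) (f : {ffun V3 -> V2}) : config G' :=
  [ffun e => match e with inl e0 => x e0 | inr ab => f ab.1 == ab.2 end].

Lemma restrict_extend x f : restrict_config V3 (extend_config x f) = x.
Proof. by apply/ffunP => e; rewrite !ffunE. Qed.

Lemma extend_config_inj x : injective (extend_config x).
Proof.
move=> f g /ffunP fg; apply/ffunP => a.
by have := fg (inr (a, f a)); rewrite !ffunE /= eqxx => /esym/eqP.
Qed.

(** The degree of [b] in the extension is its degree under [x] plus the size of the fibre of [f]
    over [b]. Bounding this by 1 keeps [f] off matched nodes and makes it injective. *)
Lemma perfect_matching_extend (x : config G) (f : {ffun V3 -> V2}) :
  perfect_matching x ->
  perfect_matching (extend_config x f)
  = (f \in ffun_on (mem (unmatched x))) && injectiveb f.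
Proof.
case/andP=> /forallP hA /forallP hB.
have new b : [pred a | extend_config x f (inr (a, b))] =i [pred a | f a == b].
  by move=> a; rewrite !inE ffunE.
apply/andP/andP => [[_ /forallP h]|[/ffun_onP hf /injectiveP finj]].
  have {}h b : (degree x (inr b) + #|[pred a | f a == b]| <= 1)%N.
    by have := h b; rewrite degree_balanced_inr restrict_extend (eq_card (new b)).
  split.
    apply/ffun_onP => a; rewrite !inE -leqn0 -ltnS.
    (* The fibre over [f a] contains [a], which leaves no room for an edge of [x] at [f a]. *)
    apply: leq_trans (h (f a)); rewrite -addn1 leq_add2l.
    by apply/card_gt0P; exists a; rewrite inE.
  apply/injectiveP => a c fac.
  have /card_le1_eqP le1 : (#|[pred i | f i == f c]| <= 1)%N.
    by apply: leq_trans (h (f c)); exact: leq_addl.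
  by apply: le1; rewrite !inE ?fac.
split; [apply/forallP => -[] a | apply/forallP => b].
- by rewrite degree_balanced_inll restrict_extend.
- rewrite degree_balanced_inlr (eq_card (_ : _ =i pred1 (f a))) ?card1 // => b.
  by rewrite !inE ffunE eq_sym.
rewrite degree_balanced_inr restrict_extend (eq_card (new b)).
(* Over an unmatched [b] injectivity bounds the fibre; over a matched [b] the fibre is empty. *)
have [b0|b0] := eqVneq (degree x (inr b)) 0%N.
  rewrite b0; apply/card_le1_eqP => a c; rewrite !inE => /eqP fa /eqP fc.
  by apply: finj; rewrite fa.
rewrite [X in (_ + X)%N]eq_card0 ?addn0 // => a; rewrite !inE.
by apply: contraNF b0 => /eqP <-; have := hf a; rewrite inE.
Qed.

(** All edges at a new node are new and exactly one of them is chosen; its other endpoint is the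
    value of [f]. *)
Lemma perfect_matching_is_extension (x' : config G') : perfect_matching x' ->
  exists f, x' = extend_config (restrict_config V3 x') f.
Proof.
case/andP=> /forallP hA _.
have /fin_all_exists[f hf] a : exists b, [pred b | x' (inr (a, b))] =i pred1 b.
  by apply/card1P; rewrite -degree_balanced_inlr.
exists (finfun f); apply/ffunP => -[e|[a b]]; rewrite !ffunE //=.
by have := hf a b; rewrite !inE eq_sym.
Qed.

Lemma card_extensions (x : config G) : perfect_matching x ->
  #|[set x' : config G' | perfect_matching x' & restrict_config V3 x' == x]|
  = ((#|V2| - #|V1|) ^_ #|V3|)%N.
Proof.
move=> hx; rewrite -(card_unmatched hx) -card_inj_ffuns_on.
rewrite -(card_imset _ (@extend_config_inj x)).
apply: eq_card => x'; rewrite inE; apply/andP/imsetP.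
  case=> hx' /eqP rx'; have [f Ef] := perfect_matching_is_extension hx'.
  rewrite rx' in Ef; exists f => //.
  by rewrite inE -perfect_matching_extend // -Ef.
case=> f; rewrite inE -perfect_matching_extend // => hf ->.
by rewrite restrict_extend.
Qed.

Lemma sum_weight_extensions (R : realType) (lambda : edge G -> R)
    (x : config G) :
  perfect_matching x ->
  \sum_(x' : config G' | perfect_matching x' && (restrict_config V3 x' == x))
     weight (balanced_weight V3 lambda) x'
  = weight lambda x *+ ((#|V2| - #|V1|) ^_ #|V3|).
Proof.
move=> hx; rewrite -(card_extensions hx) -sumr_const.
apply: eq_big => [x'|x' /andP[_ /eqP <-]]; last exact: weight_balanced.
by rewrite inE.
Qed.

Lemma total_weight_balanced (R : realType) (lambda : edge G -> R) :
  total_weight (balanced_weight V3 lambda)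
  = total_weight lambda *+ ((#|V2| - #|V1|) ^_ #|V3|).
Proof.
(* Perfect matchings of [G'] are grouped by their restriction, and each group contributes the same
   multiple. *)
rewrite /total_weight (partition_big (restrict_config V3) (@perfect_matching _ _ G)).
  by rewrite -sumrMnl; apply: eq_bigr => x; exact: sum_weight_extensions.
exact: perfect_matching_restrict.
Qed.

Lemma pm_dist_restrict (R : realType) (lambda : edge G -> R) (x : config G) :
  (#|V3| <= #|V2| - #|V1|)%N ->
  \sum_(x' | restrict_config V3 x' == x) pm_dist (balanced_weight V3 lambda) x'
  = pm_dist lambda x.
Proof.
(* The cardinality bound says that the number of extensions is positive, so this factor cancels in
   the quotient. *)
rewrite -ffact_gt0 => N_gt0; rewrite -big_mkcondl /= -mulr_suml /pm_dist.
case: ifP => hx.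
  rewrite sum_weight_extensions // total_weight_balanced.
  rewrite -mulr_natr -[X in _ / X]mulr_natr -mulf_div divff ?mulr1 //.
  by rewrite pnatr_eq0 -lt0n.
(* If [x] is not a perfect matching, no perfect matching of [G'] restricts to it and the sum is
   empty. *)
rewrite big1 ?mul0r // => x' /andP[/perfect_matching_restrict + /eqP rx'].
by rewrite rx' hx.
Qed.

End Balanced.

Theorem mainTheorem6 (R : realType) (V1 V2 V3 : finType) (G : bigraph V1 V2)
    (lambda : edge G -> R)
    (hV : (#|V1| < #|V2|)%N)
    (hV3 : #|V3| = (#|V2| - #|V1|)%N)
    (hlambda : forall e : edge G, 0 <= lambda e)
    (hZ : 0 < total_weight lambda) :
  0 < total_weight (balanced_weight V3 lambda) /\
  forall (d : measure_display) (T : measurableType d) (P : probability T R)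
         (X' : T -> config (balanced_graph V3 G)),
    has_law P X' (pm_dist (balanced_weight V3 lambda)) ->
    has_law P (fun t => restrict_config V3 (X' t)) (pm_dist lambda).
Proof.
split; first by rewrite total_weight_balanced pmulrn_lgt0 // ffact_gt0 hV3.
move=> d T P X' /(has_law_comp (restrict_config V3)) hX x.
by have := hX x; rewrite pm_dist_restrict ?hV3.
Qed.
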